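(* The integers $A_n$ with $n\ge 2$ are positive and increasing; that is, $A_n>0$ and $A_{n+1}>A_n$ for every integer $n\ge 2$.
   Context: For $n\ge 0$ let $C_n=\frac{1}{n+1}\binom{2n}{n}$ be the $n$-th Catalan number. The integers $A_n$, $n\ge 1$, are defined inductively by \[(-1)^{n-1}A_n=C_n+\sum_{j=1}^{n-1}(-1)^{j}\binom{2n-1}{2j-1}A_j\,C_{n-j}\qquad (n\ge 1).\] In particular $A_1=1$. *)

(* Defs.v *)
From HB Require Import structures.
From mathcomp Require Import all_boot all_order all_algebra.

Set Implicit Arguments.
Unset Strict Implicit.
Unset Printing Implicit Defensive.

Import Order.TTheory GRing.Theory Num.Theory.
Local Open Scope ring_scope.

(* The division is exact: see catalanE. *)
Definition catalan (n : nat) : nat := ('C(2 * n, n) %/ n.+1)%N.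

Lemma catalanE (n : nat) : (n.+1 * catalan n = 'C(2 * n, n))%N.
Proof.
rewrite /catalan mulnC divnK //.
have: (n.+1 %| n * 'C(2 * n, n))%N.
  have := mul_bin_left (2 * n) n.
  by rewrite mul2n -addnn addnK => <-; apply: dvdn_mulr.
by rewrite Gauss_dvdr // coprimeSn.
Qed.

(* The right-hand side of the recursion at n; only a 1, ..., a (n - 1)
   are used. *)
Definition A_rhs (a : nat -> int) (n : nat) : int :=
  (catalan n)%:Z
  + \sum_(1 <= j < n)
      (-1) ^+ j * ('C(2 * n - 1, 2 * j - 1))%:Z * a j * (catalan (n - j))%:Z.

(* A_prefix n = [:: 0; A_1; ...; A_n]; the entry at index 0 is a dummy.
   Multiplying by the sign (-1)^(n-1), its own inverse, solves the recursion
   for A_n. *)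
Fixpoint A_prefix (n : nat) : seq int :=
  if n is m.+1 then
    rcons (A_prefix m) ((-1) ^+ m * A_rhs (nth 0 (A_prefix m)) m.+1)
  else [:: 0].

Definition A (n : nat) : int := nth 0 (A_prefix n) n.

Lemma size_A_prefix (n : nat) : size (A_prefix n) = n.+1.
Proof. by elim: n => //= n IHn; rewrite size_rcons IHn. Qed.

Lemma nth_A_prefix (n j : nat) : (j <= n)%N -> nth 0 (A_prefix n) j = A j.
Proof.
elim: n => [|n IHn]; first by rewrite leqn0 => /eqP->.
rewrite leq_eqVlt => /predU1P[-> //|lt_jn].
by rewrite /= nth_rcons size_A_prefix lt_jn IHn.
Qed.

Lemma A_rec (n : nat) : (1 <= n)%N ->
  (-1) ^+ (n - 1) * A n =
  (catalan n)%:Z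
  + \sum_(1 <= j < n)
      (-1) ^+ j * ('C(2 * n - 1, 2 * j - 1))%:Z * A j * (catalan (n - j))%:Z.
Proof.
case: n => // m _; rewrite subn1 /= {1}/A /= nth_rcons size_A_prefix.
rewrite ltnn eqxx mulrA -expr2 sqrr_sign mul1r /A_rhs; congr (_ + _).
rewrite !big_nat; apply: eq_bigr => j /andP[_ lt_jm].
by rewrite nth_A_prefix.
Qed.

Lemma A1 : A 1 = 1.
Proof.
by have := A_rec (leqnn 1); rewrite subnn expr0 mul1r big_geq // addr0.
Qed.

(* Main.v *)
Require Import Defs.
From HB Require Import structures.
From mathcomp Require Import all_boot all_order all_algebra.
From mathcomp Require Import zify ring lra.

Import Order.TTheory GRing.Theory Num.Theory.
Local Open Scope ring_scope.

(** With [g(z) = \sum_n (-1)^n C_n z^(2n) / (2n)!], the defining recursion says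
    that [- g' / g = \sum_n A_n z^(2n-1) / (2n-1)!].  Since
    [C_n / (2n)! = 1 / (n! (n+1)!)], the function [g] is [J_1(2z) / z], so it
    satisfies the linear Bessel equation [g'' + (3/z) g' + 4 g = 0], and its
    logarithmic derivative satisfies a Riccati equation.  Reading off the
    coefficients of the latter expresses each [A_n] as a sum of products
    [A_i A_(n-i)] with positive weights ([normA_convolution]), whereas the
    defining recursion has alternating signs.  Positivity follows at once.  For
    [n >= 3] the two extreme terms of the sum, which are distinct and contain
    [A_1 = 1], together already exceed [A_(n-1)].

    In the variable [x = z^2], with [g = G(x)] and [- g' / g = z K(x)], the
    definition of [K] is [K G = -2 G'], the Bessel equation is
    [x G'' + 2 G' + G = 0], and the Riccati equation is
    [2 x K' + 4 K = 4 + x K^2].  The power series are represented by their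
    truncations, and equations hold modulo a power of ['X]. *)

(** * The generating functions and their coefficients *)

(** The coefficient of [z^(2k+1)] in [- g' / g], which is that of [x^k] in
    [K]; the shift of index makes the power series start at [x^0]. *)
Definition normA (k : nat) : rat := (A k.+1)%:~R / ((2 * k).+1)`!%:R.

(** The coefficient of [z^(2k)] in [g = J_1(2z) / z], that is,
    [(-1)^k C_k / (2k)!]. *)
Definition besselc (k : nat) : rat := (-1) ^+ k / (k`! * k.+1`!)%:R.

Definition besselP (N : nat) : {poly rat} := \poly_(i < N) besselc i.

Definition normAP (N : nat) : {poly rat} := \poly_(i < N) normA i.

Lemma natr_fact_neq0 (n : nat) : n`!%:R != 0 :> rat.
Proof. by rewrite pnatr_eq0 -lt0n fact_gt0. Qed.

Lemma A_normA (n : nat) : (A n.+1)%:~R = normA n * ((2 * n).+1)`!%:R.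
Proof. by rewrite /normA divfK ?natr_fact_neq0. Qed.

Lemma catalan_fact (m : nat) :
  (catalan m * (m`! * m.+1`!) = (2 * m)`!)%N.
Proof.
have le_m2m : (m <= 2 * m)%N by lia.
have := bin_fact le_m2m; rewrite -catalanE mul2n -addnn addnK => <-.
by rewrite factS; ring.
Qed.

Lemma catalan_besselc (m : nat) :
  (catalan m)%:R / (2 * m)`!%:R = (-1) ^+ m * besselc m.
Proof.
rewrite /besselc mulrA -expr2 sqrr_sign mul1r -catalan_fact natrM.
have c0 : (catalan m)%:R != 0 :> rat.
  rewrite pnatr_eq0; apply/eqP => c0.
  by have := catalan_fact m; have := fact_gt0 (2 * m); rewrite c0; lia.
by rewrite invfM mulrA divff // mul1r.
Qed.

Lemma besselc0 : besselc 0 = 1.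
Proof. by rewrite /besselc expr0 divr1. Qed.

Lemma normA0 : normA 0 = 1.
Proof. by rewrite /normA A1 divr1. Qed.

(** The Bessel equation, read on coefficients. *)
Lemma besselcS (n : nat) : besselc n.+1 * n.+1%:R * n.+2%:R = - besselc n.
Proof.
have fn := natr_fact_neq0 n.
rewrite /besselc !factS exprS !natrM.
have n1 : n.+1%:R != 0 :> rat by rewrite pnatr_eq0.
have n2 : n.+2%:R != 0 :> rat by rewrite pnatr_eq0.
move: n.+1%:R n.+2%:R n`!%:R n1 n2 fn => a b c a0 b0 c0.
by field; rewrite a0 b0 c0.
Qed.

(** The recursion of [A] divided by [(2n+1)!]; the term of [A_(n+1)] itself
    is the summand [j = n], because [C_0 = 1]. *)
Lemma normA_besselc (n : nat) :
  \sum_(j < n.+1) normA j * besselc (n - j)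
  = - (2 * n.+1%:R * besselc n.+1).
Proof.
have term j : (j <= n)%N ->
    ((-1) ^+ j.+1 * ('C(2 * n.+1 - 1, 2 * j.+1 - 1))%:Z * A j.+1
      * (catalan (n.+1 - j.+1))%:Z)%:~R
    = - ((-1) ^+ n * (2 * n).+1`!%:R * (normA j * besselc (n - j))) :> rat.
  move=> le_jn; rewrite !intrM rmorph_sign -!pmulrn subSS /normA.
  have -> : (2 * n.+1 - 1 = (2 * n).+1)%N by lia.
  have -> : (2 * j.+1 - 1 = (2 * j).+1)%N by lia.
  have le_j : ((2 * j).+1 <= (2 * n).+1)%N by lia.
  have -> : (-1) ^+ n = (-1) ^+ j * (-1) ^+ (n - j) :> rat.
    by rewrite -exprD subnKC.
  rewrite -(bin_fact le_j) subSS -mulnBr.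
  have := natr_fact_neq0 (2 * j).+1; move: ((2 * j).+1)`! => f f0.
  rewrite !natrM exprS.
  have c := catalan_besselc (n - j).
  have -> : (catalan (n - j))%:R
      = (-1) ^+ (n - j) * besselc (n - j) * (2 * (n - j))`!%:R :> rat.
    by rewrite -c divfK ?natr_fact_neq0.
  by field.
have := congr1 (fun z : int => z%:~R : rat) (A_rec (ltn0Sn n)).
rewrite subn1 /= rmorphM /= rmorphXn /= rmorphN1 rmorphD /= rmorph_sum /=.
rewrite big_add1 /= big_mkord.
rewrite (eq_bigr _ (fun (j : 'I_n) _ => term j (ltnW (ltn_ord j)))).
rewrite sumrN -mulr_sumr => rec.
rewrite big_ord_recr /= subnn besselc0 mulr1.
(* [A_rec] keeps the term [C_(n+1)] apart; here it becomes the right-hand side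
   up to the factor [(-1)^n (2n+1)!]. *)
have catE : (catalan n.+1)%:~R
    = - (2 * n.+1%:R * besselc n.+1) * ((-1) ^+ n * (2 * n).+1`!%:R) :> rat.
  have := catalan_besselc n.+1.
  move/(canRL (divfK (natr_fact_neq0 _))); rewrite -pmulrn => ->.
  have -> : ((2 * n.+1)`! = 2 * n.+1 * (2 * n).+1`!)%N by rewrite mulnS factS.
  by move: ((2 * n).+1)`! => f; rewrite !natrM exprS; ring.
have sF0 : (-1) ^+ n * (2 * n).+1`!%:R != 0 :> rat.
  by rewrite mulf_neq0 ?signr_eq0 ?natr_fact_neq0.
apply: (mulIf sF0); rewrite -catE mulrDl.
move: rec; rewrite A_normA => rec.
by rewrite mulrC [normA n * _]mulrCA rec; ring.
Qed.

(** * The Bessel and Riccati equations *)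

Lemma dvdXnP (F : fieldType) (p : {poly F}) (N : nat) :
  reflect (forall i, (i < N)%N -> p`_i = 0) ('X^N %| p).
Proof.
apply: (iffP idP) => [/dvdpP[q ->] i lt_iN|p0]; first by rewrite coefMXn lt_iN.
suff -> : p = drop_poly N p * 'X^N by apply: dvdp_mull.
rewrite -[LHS](poly_take_drop N) (_ : take_poly N p = 0) ?add0r //.
by apply/polyP => i; rewrite coef_take_poly coef0; case: ifP => // /p0.
Qed.

(** [K G = -2 G']; the derivative of a truncation is correct one degree less
    far, whence [N] on the left and [N.+1] on the right. *)
Lemma logderiv_besselP (N : nat) :
  'X^N %| normAP N.+1 * besselP N.+1 + 2%:P * (besselP N.+1)^`().
Proof.
apply/dvdXnP => i lt_iN; rewrite coefD coefCM coef_deriv coefM !coef_poly.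
rewrite ltnS lt_iN (eq_bigr (fun j : 'I_i.+1 => normA j * besselc (i - j))).
  by rewrite normA_besselc; ring.
by move=> j _; rewrite !coef_poly !ifT //; have := ltn_ord j; lia.
Qed.

Lemma bessel_equation (N : nat) :
  'X^N %| 'X * (besselP N.+1)^`()^`() + 2%:P * (besselP N.+1)^`()
          + besselP N.+1.
Proof.
apply/dvdXnP => i lt_iN.
rewrite !coefD coefCM coefXM !coef_deriv !coef_poly !ltnS lt_iN (ltnW lt_iN).
have -> : besselc i = - (besselc i.+1 * i.+1%:R * i.+2%:R).
  by rewrite besselcS opprK.
case: i lt_iN => [|i] lt_iN.
  by rewrite eqxx; ring.
by rewrite /= lt_iN; ring.
Qed.

(** Eliminating [G''] and [G'] between the Bessel equation, [K G = -2 G'] and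
    the derivative of the latter leaves [G] times the Riccati equation, and
    [G] is invertible modulo ['X^N] because [G(0) = 1]. *)
Lemma riccati_equation (N : nat) (K := normAP N.+2) :
  'X^N %| 2%:P * 'X * K^`() + 4%:P * K - 4%:P - 'X * K ^+ 2.
Proof.
pose G := besselP N.+2; set E := (X in _ %| X).
have XnW (p : {poly rat}) : 'X^(N.+1) %| p -> 'X^N %| p.
  by apply: dvdp_trans; rewrite dvdp_exp2l.
have dvdKG := logderiv_besselP N.+1; rewrite -/K -/G in dvdKG.
have dvdG := bessel_equation N.+1; rewrite -/G in dvdG.
(* Differentiating a multiple of ['X^(N.+1)] costs one power of ['X]. *)
have dvdKG' : 'X^N %| K^`() * G + K * G^`() + 2%:P * G^`()^`().
  have /dvdXnP KG0 := dvdKG; apply/dvdXnP => i lt_iN.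
  have := KG0 i.+1 lt_iN; move/(congr1 (fun c => c *+ i.+1)).
  by rewrite mul0rn -coef_deriv derivD !derivM derivC mul0r add0r.
have coGX : coprimep 'X^N G.
  rewrite coprimep_expl // -['X]subr0 -polyC0 coprimep_sym coprimep_XsubC.
  by rewrite rootE horner_coef0 coef_poly besselc0 oner_eq0.
rewrite -(Gauss_dvdpr _ coGX).
(* The Riccati expression times [G], written in terms of the relations
   [K G + 2 G'], its derivative, and the Bessel equation. *)
have -> : G * E = 2%:P * 'X * (K^`() * G + K * G^`() + 2%:P * G^`()^`())
    + (4%:P - 'X * K) * (K * G + 2%:P * G^`())
    - 4%:P * ('X * G^`()^`() + 2%:P * G^`() + G).
  have e4 : 4%:P = 4 :> {poly rat} by rewrite polyC_natr.
  have e2 : 2%:P = 2 :> {poly rat} by rewrite polyC_natr.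
  by rewrite /E e4 e2; ring.
by apply: dvdp_sub; [apply: dvdp_add|]; apply: dvdp_mull => //; apply: XnW.
Qed.

(** The coefficient of [x^(n+1)] in the Riccati equation: [2 x K'] and [4 K]
    contribute [2 (n+1) + 4 = 2 n + 6] times that of [K]. *)
Lemma normA_convolution (n : nat) :
  (2 * n + 6)%:R * normA n.+1 = \sum_(k < n.+1) normA k * normA (n - k).
Proof.
have /dvdXnP/(_ n.+1 (ltnSn _)) := riccati_equation n.+2.
rewrite !coefB coefD -mulrA !coefCM !coefXM coefC expr2 coefM coef_deriv /=.
rewrite !coef_poly !ifT; try lia.
rewrite (eq_bigr (fun k : 'I_n.+1 => normA k * normA (n - k))).
  set S := \sum_(k < _) _ => /eqP; rewrite subr0 subr_eq0 => /eqP <-.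
  by ring.
by move=> k _; rewrite !coef_poly !ifT //; have := ltn_ord k; lia.
Qed.

(** * Positivity and growth *)

Lemma normA_gt0 (n : nat) : 0 < normA n.
Proof.
elim/ltn_ind: n => -[|n] IHn; first by rewrite normA0.
rewrite -(pmulr_rgt0 _ (_ : 0 < (2 * n + 6)%:R)) ?ltr0n ?addn_gt0 ?orbT //.
rewrite normA_convolution (bigD1 ord0) //=; apply: ltr_pwDl.
  by rewrite mulr_gt0 ?IHn // subn0.
by apply: sumr_ge0 => k _; rewrite ltW // mulr_gt0 ?IHn // ltnS leq_subr.
Qed.

(** The two extreme terms of the convolution bound it from below; they are
    distinct because the sum for [n.+2] has at least two terms. *)
Lemma normA_growth (n : nat) : 2 * normA n.+1 <= (2 * n + 8)%:R * normA n.+2.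
Proof.
have -> : (2 * n + 8 = 2 * n.+1 + 6)%N by lia.
rewrite normA_convolution big_ord_recl big_ord_recr /= /bump /= add1n.
rewrite subn0 subnn normA0 mulr1 mul1r mulr_natl mulr2n lerD2l lerDr.
by apply: sumr_ge0 => k _; rewrite mulr_ge0 // ltW // normA_gt0.
Qed.

Theorem theorem1 (n : nat) (hn : (2 <= n)%N) : 0 < A n /\ A n < A n.+1.
Proof.
case: n hn => [|[|n]] // _.
rewrite -(ltr0z rat) -(ltr_int rat) !A_normA.
have f0 : 0 < ((2 * n.+1).+1)`!%:R :> rat by rewrite ltr0n fact_gt0.
have h0 := normA_gt0 n.+1; have g := normA_growth n.
split; first exact: mulr_gt0.
(* In [A_(n+3)], the factorial grows by [(2n+5)(2n+4)], while the growth bound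
   loses only a factor [n+4]. *)
have -> : ((2 * n.+2).+1`! = (2 * n + 5) * (2 * n + 4) * (2 * n.+1).+1`!)%N.
  have -> : ((2 * n.+2).+1 = (2 * n.+1).+3)%N by lia.
  by rewrite !factS; lia.
rewrite natrM mulrA ltr_pM2r //.
have nE c : (2 * n + c)%:R = 2 * n%:R + c%:R :> rat by rewrite natrD natrM.
rewrite natrM !nE; rewrite nE in g.
have n0 : 0 <= n%:R :> rat by [].
nra.
Qed.
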